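(* Let $n \geq 1$. For full-rank lattices $L, L' \subset \mathbb{R}^n$ define $$\mathrm{scale}(L,L') = \min\{ s > 0 : R(V(L)) \subset s\,V(L') \text{ for some } R \in SO(n)\},$$ $$d_s(L,L') = \ln\big(\max\{ \mathrm{scale}(L,L'), \mathrm{scale}(L',L)\}\big)$$ (natural logarithm). Then $d_s$ is independent of the representation of the lattices (it depends only on the lattices $L, L'$ as point sets, not on chosen bases or unit cells), and it satisfies: (a) $d_s(L,L') \geq 0$, and $d_s(L,L') = 0$ if and only if $L$ and $L'$ are equivalent, i.e. $R(L) = L'$ for some $R \in SO(n)$; (b) $d_s(L,L') = d_s(L',L)$ for all $L, L'$; (c) $d_s(L,L') + d_s(L',L'') \geq d_s(L,L'')$ for all $L, L', L''$; (d) $d_s$ changes continuously under perturbations of the lattices: if $L(B)$ denotes the lattice generated by the columns of an invertible real $n\times n$ matrix $B$, then $(B,B') \mapsto d_s(L(B),L(B'))$ is continuous on $GL_n(\mathbb{R}) \times GL_n(\mathbb{R})$; (e) $d_s(\lambda L, \lambda L') = d_s(L,L')$ for every $\lambda > 0$, where $\lambda L = \{\lambda p : p \in L\}$.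
   Context: A (full-rank) lattice in $\mathbb{R}^n$ is the set $L = \{ x_1 u_1 + \dots + x_n u_n : x_i \in \mathbb{Z}\}$ for a basis $u_1,\dots,u_n$ of $\mathbb{R}^n$; in particular $0 \in L$. The Voronoi cell of $L$ is $V(L) = \{ p \in \mathbb{R}^n : d(p,0) \leq d(p,q) \text{ for all } q \in L \setminus \{0\}\}$, where $d$ is the Euclidean distance; it is a convex polytope centrally symmetric about $0$ with nonempty interior. For $s>0$ and $C\subset\mathbb{R}^n$, $sC = \{ s p : p \in C\}$. $SO(n)$ is the group of real $n \times n$ orthogonal matrices of determinant $1$ (rotations about the origin). Two lattices are called equivalent if one is obtained from the other by an orientation-preserving rigid motion of $\mathbb{R}^n$; for lattices (which contain $0$) this is the same as $R(L)=L'$ for some $R\in SO(n)$. *)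

(* Defs.v *)
From HB Require Import structures.
From mathcomp Require Import all_boot all_order all_algebra.
From mathcomp Require Import all_classical all_reals all_analysis.
Set Implicit Arguments. Unset Strict Implicit. Unset Printing Implicit Defensive.
Import Order.TTheory GRing.Theory Num.Theory.
Import numFieldNormedType.Exports.
Local Open Scope classical_set_scope.
Local Open Scope ring_scope.

Section Lattices.
Variables (R : realType) (n : nat).

Definition edist (p q : 'cV[R]_n) : R :=
  Num.sqrt (\sum_(i < n) (p i ord0 - q i ord0) ^+ 2).

Definition latt (B : 'M[R]_n) : set 'cV[R]_n :=
  [set p | exists x : 'I_n -> int,
      p = \sum_(i < n) ((x i)%:~R : R) *: col i B].

Definition is_lattice (L : set 'cV[R]_n) : Prop :=
  exists B : 'M[R]_n, B \in unitmx /\ L = latt B.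

Definition voronoi (L : set 'cV[R]_n) : set 'cV[R]_n :=
  [set p | forall q, L q -> q != 0 -> edist p 0 <= edist p q].

Definition is_rot (Q : 'M[R]_n) : Prop := Q^T *m Q = 1%:M /\ \det Q = 1.

Definition rot_img (Q : 'M[R]_n) (C : set 'cV[R]_n) : set 'cV[R]_n :=
  (fun p => Q *m p) @` C.

Definition dil (s : R) (C : set 'cV[R]_n) : set 'cV[R]_n :=
  (fun p => s *: p) @` C.

Definition scale_set (L L' : set 'cV[R]_n) : set R :=
  [set s | 0 < s /\ exists Q, is_rot Q /\ rot_img Q (voronoi L) `<=` dil s (voronoi L')].

(* scale(L,L') = min of scale_set (defined as the infimum; the theorem
   asserts the minimum is attained). *)
Definition scale (L L' : set 'cV[R]_n) : R := inf (scale_set L L').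

Definition d_s (L L' : set 'cV[R]_n) : R :=
  ln (Num.max (scale L L') (scale L' L)).

End Lattices.

(* Main.v *)
Require Import Defs.
From HB Require Import structures.
From mathcomp Require Import all_boot all_order all_algebra.
From mathcomp Require Import all_classical all_reals all_analysis.
From mathcomp Require Import zify ring lra.
Import Order.TTheory GRing.Theory Num.Theory.
Import numFieldNormedType.Exports.
Local Open Scope classical_set_scope.
Local Open Scope ring_scope.
Set Implicit Arguments.
Unset Strict Implicit.
Unset Printing Implicit Defensive.

(** A minimizing family of rotations has a cluster point by compactness of
    SO(n), so the scale is attained, and composing inclusions makes it
    submultiplicative.  Nonnegativity needs no volumes: the least [s] with
    [Q V <= s V] satisfies [s <= s ^ 2].  If both scales are [1], a rotation
    mapping [V] into itself maps it onto itself by recurrence, so the Voronoi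
    cells are congruent; and a lattice is determined by its cell, because a
    shortest vector [v] lying in one lattice but not in another one with the
    same cell is the only vector active at [v / 2].  For continuity, if
    [|B x - C x| <= d |C x|] for all [x], then
    [V(L(B)) <= ((1 + d) ^ 2 + 2 r d / m) V(L(C))], where [r] bounds the
    circumradius of the first cell and [m] the minimal norm of [L(C)]; the
    triangle inequality turns this estimate at one point into joint
    continuity. *)

(** * Euclidean geometry and Voronoi cells *)

Section Euclid.
Variables (R : realType) (n : nat).
Implicit Types (u v w p q : 'cV[R]_n) (A B Q : 'M[R]_n).

Definition dot u v : R := (u^T *m v) ord0 ord0.
Definition nrm u : R := Num.sqrt (dot u u).

Lemma dotE u v : dot u v = \sum_i u i ord0 * v i ord0.
Proof. by rewrite /dot mxE; apply: eq_bigr => i _; rewrite mxE. Qed.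

Lemma dotC u v : dot u v = dot v u.
Proof. by rewrite !dotE; apply: eq_bigr => i _; rewrite mulrC. Qed.

Lemma dotDr u v w : dot u (v + w) = dot u v + dot u w.
Proof. by rewrite /dot mulmxDr mxE. Qed.

Lemma dotZr a u v : dot u (a *: v) = a * dot u v.
Proof. by rewrite /dot -scalemxAr mxE. Qed.

Lemma dotNr u v : dot u (- v) = - dot u v.
Proof. by rewrite -scaleN1r dotZr mulN1r. Qed.

Lemma dotDl u v w : dot (u + v) w = dot u w + dot v w.
Proof. by rewrite dotC dotDr !(dotC w). Qed.

Lemma dotZl a u v : dot (a *: u) v = a * dot u v.
Proof. by rewrite dotC dotZr dotC. Qed.

Lemma dotNl u v : dot (- u) v = - dot u v.
Proof. by rewrite dotC dotNr dotC. Qed.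

Lemma dot0l v : dot 0 v = 0.
Proof. by rewrite -(scale0r v) dotZl mul0r. Qed.

Definition dotS := (dotDr, dotDl, dotNr, dotNl, dotZr, dotZl).

Lemma dot_ge0 u : 0 <= dot u u.
Proof. by rewrite dotE sumr_ge0// => i _; rewrite -expr2 sqr_ge0. Qed.

Lemma dot_eq0 u : dot u u = 0 -> u = 0.
Proof.
rewrite dotE => /eqP; rewrite psumr_eq0; last by move=> i _; rewrite -expr2 sqr_ge0.
move=> /allP h; apply/matrixP => i j; rewrite (ord1 j) mxE.
by move: (h i (mem_index_enum i)); rewrite /= mulf_eq0 orbb => /eqP.
Qed.

Lemma dot_gt0 u : u != 0 -> 0 < dot u u.
Proof.
move=> u0; rewrite lt_neqAle dot_ge0 andbT eq_sym.
by apply: contra_neq u0; exact: dot_eq0.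
Qed.

Lemma nrm_ge0 u : 0 <= nrm u.
Proof. exact: sqrtr_ge0. Qed.
Hint Resolve nrm_ge0 : core.

Lemma sqr_nrm u : nrm u ^+ 2 = dot u u.
Proof. by rewrite sqr_sqrtr ?dot_ge0. Qed.

Lemma nrm_gt0 u : u != 0 -> 0 < nrm u.
Proof. by move=> u0; rewrite sqrtr_gt0 dot_gt0. Qed.

Lemma nrm0 : nrm 0 = 0.
Proof. by rewrite /nrm dot0l sqrtr0. Qed.

Lemma nrm_le u c : 0 <= c -> dot u u <= c ^+ 2 -> nrm u <= c.
Proof. by move=> c0 h; rewrite -ler_sqr ?nnegrE// sqr_nrm. Qed.

Lemma nrmZ a u : nrm (a *: u) = `|a| * nrm u.
Proof. by rewrite /nrm dotZr dotZl mulrA -expr2 sqrtrM ?sqr_ge0// sqrtr_sqr. Qed.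

Lemma nrmN u : nrm (- u) = nrm u.
Proof. by rewrite /nrm dotNr dotNl opprK. Qed.

Lemma nrmB u v : nrm (u - v) = nrm (v - u).
Proof. by rewrite -nrmN opprB. Qed.

(* Expanding [|c u - b v|^2 >= 0] with [b = dot u v], [c = dot v v]. *)
Lemma dot_sqr_le u v : dot u v ^+ 2 <= dot u u * dot v v.
Proof.
have [->|v0] := eqVneq v 0; first by rewrite !(dotC _ 0) !dot0l expr0n/= mulr0.
have := dot_ge0 (dot v v *: u - dot u v *: v).
rewrite !dotS (dotC v u) => h.
have h' : 0 <= dot v v * (dot u u * dot v v - dot u v ^+ 2) by move: h; nra.
by rewrite pmulr_rge0 ?dot_gt0// subr_ge0 in h'.
Qed.

Lemma dot_le u v : dot u v <= nrm u * nrm v.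
Proof.
apply: (le_trans (ler_norm _)); rewrite -ler_sqr ?nnegrE ?mulr_ge0//.
by rewrite exprMn !sqr_nrm real_normK ?num_real// dot_sqr_le.
Qed.

Lemma nrmD u v : nrm (u + v) <= nrm u + nrm v.
Proof.
apply: nrm_le; first exact: addr_ge0.
by rewrite !dotS (dotC v u) sqrrD !sqr_nrm; have := dot_le u v; lra.
Qed.

Lemma coord_le_nrm u i : `|u i ord0| <= nrm u.
Proof.
rewrite -ler_sqr ?nnegrE// sqr_nrm real_normK ?num_real// dotE (bigD1 i)//= -expr2.
by rewrite lerDl sumr_ge0// => j _; rewrite -expr2 sqr_ge0.
Qed.

Lemma nrm_sum I (r : seq I) (F : I -> 'cV[R]_n) :
  nrm (\sum_(i <- r) F i) <= \sum_(i <- r) nrm (F i).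
Proof.
elim/big_ind2: _ => [|x1 x2 y1 y2 h1 h2|//]; first by rewrite nrm0.
exact: le_trans (nrmD _ _) (lerD h1 h2).
Qed.

(** Cauchy-Schwarz on each row bounds a squared coordinate by [n * e ^ 2 * |u| ^ 2]; summing over
    the [n] rows gives the factor [n]. *)
Lemma nrm_mulmx_le A e u : 0 <= e -> (forall i j, `|A i j| <= e) ->
  nrm (A *m u) <= n%:R * e * nrm u.
Proof.
move=> e0 Ae; apply: nrm_le; first by rewrite !mulr_ge0.
have row i : ((A *m u) i ord0) ^+ 2 <= n%:R * e ^+ 2 * dot u u.
  have -> : (A *m u) i ord0 = dot (row i A)^T u.
    by rewrite mxE dotE; apply: eq_bigr => j _; rewrite !mxE.
  apply: (le_trans (dot_sqr_le _ _)); rewrite ler_wpM2r ?dot_ge0//.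
  rewrite dotE -[X in X%:R * _](card_ord n) -sum1_card natr_sum mulr_suml.
  apply: ler_sum => j _; rewrite !mxE mul1r -expr2 -(@real_normK _ (A i j)) ?num_real//.
  by rewrite ler_sqr ?nnegrE.
rewrite dotE !exprMn sqr_nrm.
have -> : n%:R ^+ 2 * e ^+ 2 * dot u u = \sum_(i < n) n%:R * e ^+ 2 * dot u u.
  by rewrite sumr_const card_ord -mulr_natl; ring.
by apply: ler_sum => i _; rewrite -expr2.
Qed.

Lemma mulmx_bounded A : exists2 K, 0 < K & forall u, nrm (A *m u) <= K * nrm u.
Proof.
pose e := \sum_i \sum_j `|A i j|.
have e0 : 0 <= e by rewrite sumr_ge0// => i _; rewrite sumr_ge0.
(* The summand 1 keeps the constant strictly positive even for [A = 0]. *)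
exists (n%:R * e + 1) => [|u]; first by rewrite ltr_wpDl ?mulr_ge0.
apply: (@le_trans _ _ (n%:R * e * nrm u)); last by rewrite ler_wpM2r// lerDl.
apply: nrm_mulmx_le => // i j; rewrite /e (bigD1 i)//= (bigD1 j)//= -addrA lerDl.
by rewrite addr_ge0 ?sumr_ge0// => k _; rewrite sumr_ge0.
Qed.

(** * Rotations *)

Lemma dot_rot Q u v : is_rot Q -> dot (Q *m u) (Q *m v) = dot u v.
Proof. by case=> QQ _; rewrite /dot trmx_mul mulmxA -(mulmxA _ Q^T) QQ mulmx1. Qed.

Lemma nrm_rot Q u : is_rot Q -> nrm (Q *m u) = nrm u.
Proof. by move=> rQ; rewrite /nrm dot_rot. Qed.

Lemma rot_mulKV Q : is_rot Q -> Q *m Q^T = 1%:M.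
Proof. by case=> QQ _; exact: mulmx1C. Qed.

Lemma rotT Q : is_rot Q -> is_rot Q^T.
Proof. by move=> rQ; split; rewrite ?trmxK ?rot_mulKV// det_tr; case: rQ. Qed.

Lemma rotM Q Q' : is_rot Q -> is_rot Q' -> is_rot (Q *m Q').
Proof.
case=> QQ dQ [QQ' dQ']; split; last by rewrite det_mulmx dQ dQ' mulr1.
by rewrite trmx_mul mulmxA -(mulmxA _ Q^T) QQ mulmx1.
Qed.

Lemma rot1 : is_rot (1%:M : 'M[R]_n).
Proof. by split; rewrite ?trmx1 ?mulmx1 ?det1. Qed.

Lemma rot_entry_le Q i j : is_rot Q -> `|Q i j| <= 1.
Proof.
move=> rQ; have -> : Q i j = (Q *m delta_mx j (ord0 : 'I_1)) i ord0.
  by rewrite -colE mxE.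
apply: (le_trans (coord_le_nrm _ _)); rewrite nrm_rot//.
apply: nrm_le => //; rewrite dotE (bigD1 j)//= big1 => [|k kj].
  by rewrite !mxE !eqxx mulr1 addr0 expr1n.
by rewrite !mxE (negbTE kj) mul0r.
Qed.

(** Squaring cancels [|p| ^ 2], so each Voronoi condition becomes a half-space inequality, linear in
    [p]. *)
Lemma edist_le_dot p q : (Defs.edist p 0 <= Defs.edist p q) = (2 * dot p q <= dot q q).
Proof.
have e u v : Defs.edist u v = nrm (u - v).
  by rewrite /Defs.edist /nrm dotE; congr Num.sqrt; apply: eq_bigr => i _; rewrite !mxE expr2.
rewrite !e subr0 ler_sqrt ?dot_ge0// !dotS (dotC q p).
by apply/idP/idP; lra.
Qed.

Lemma voronoiE (L : set 'cV[R]_n) p :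
  voronoi L p <-> forall q, L q -> 2 * dot p q <= dot q q.
Proof.
split=> [h q Lq|h q Lq _]; last by rewrite edist_le_dot h.
have [->|q0] := eqVneq q 0; first by rewrite dotC !dot0l mulr0.
by rewrite -edist_le_dot h.
Qed.

Lemma rot_imgK Q (C : set 'cV[R]_n) p : is_rot Q ->
  rot_img Q C p <-> C (Q^T *m p).
Proof.
move=> rQ; split=> [[x Cx <-]|h]; first by case: rQ => QQ _; rewrite mulmxA QQ mul1mx.
by exists (Q^T *m p) => //; rewrite mulmxA rot_mulKV// mul1mx.
Qed.

Lemma dilE s (C : set 'cV[R]_n) p : 0 < s -> dil s C p <-> C (s^-1 *: p).
Proof.
move=> s0; split=> [[x Cx <-]|h]; first by rewrite scalerA mulVf ?gt_eqF// scale1r.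
by exists (s^-1 *: p) => //; rewrite scalerA mulfV ?gt_eqF// scale1r.
Qed.

Lemma dil_voronoiE s (L : set 'cV[R]_n) p : 0 < s ->
  dil s (voronoi L) p <-> forall q, L q -> 2 * dot p q <= s * dot q q.
Proof.
move=> s0; rewrite dilE// voronoiE; split=> h q /h; rewrite dotZl.
  by rewrite mulrCA ler_pdivrMl.
by rewrite mulrCA ler_pdivrMl.
Qed.

Lemma voronoi_rot Q (L : set 'cV[R]_n) : is_rot Q ->
  voronoi (rot_img Q L) = rot_img Q (voronoi L).
Proof.
move=> rQ; apply/seteqP; split=> p.
  move=> /voronoiE h; apply/rot_imgK => //; apply/voronoiE => q Lq.
  have -> : dot (Q^T *m p) q = dot p (Q *m q).
    by rewrite -(dot_rot _ q rQ) mulmxA rot_mulKV// mul1mx.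
  rewrite -(dot_rot q q rQ).
  by apply: h; exists q.
move=> [x /voronoiE h <-]; apply/voronoiE => _ [q Lq <-].
by rewrite !dot_rot//; exact: h.
Qed.

Lemma voronoi_dil s (L : set 'cV[R]_n) : 0 < s ->
  voronoi (dil s L) = dil s (voronoi L).
Proof.
move=> s0; apply/seteqP; split=> p.
  move=> /voronoiE h; apply/dil_voronoiE => // q Lq.
  have /h : dil s L (s *: q) by exists q.
  rewrite !dotS => h'; rewrite -(ler_pM2l s0); lra.
move=> /(dil_voronoiE _ _ s0) h; apply/voronoiE => _ [q Lq <-].
rewrite !dotS mulrCA (ler_pM2l s0); exact: h.
Qed.

End Euclid.

#[local] Hint Extern 0 (is_true (0 <= nrm _)) => exact: nrm_ge0 : core.

(** * Compactness of the rotation group *)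

Section Compact.
Variables (R : realType) (n : nat).
Implicit Types (Q : 'M[R]_n).

Lemma continuous_det : continuous (fun Q : 'M[R]_n => \det Q : R).
Proof.
rewrite /determinant; apply: continuous_big => [|s _ Q]; first exact: add_continuous.
apply: continuous_comp; last exact: mulrl_continuous.
move: Q; apply: continuous_big => [|i _]; first exact: mul_continuous.
exact: coord_continuous.
Qed.

Lemma continuous_gram i j : continuous (fun Q : 'M[R]_n => (Q^T *m Q) i j : R).
Proof.
have -> : (fun Q : 'M[R]_n => (Q^T *m Q) i j : R) = fun Q => \sum_k Q k i * Q k j.
  by apply/funext => Q; rewrite mxE; apply: eq_bigr => k _; rewrite mxE.
apply: continuous_big => [|k _ Q]; first exact: add_continuous.
exact: (continuousM (coord_continuous (x := Q)) (coord_continuous (x := Q))).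
Qed.

(** The rotations are cut out by finitely many polynomial equations: the entries of [Q^T *m Q] and
    the determinant. *)
Lemma closed_rot : closed [set Q : 'M[R]_n | is_rot Q].
Proof.
have cl (f : 'M[R]_n -> R) c : continuous f -> closed [set Q | f Q = c].
  by move=> cf; apply: (@closed_comp _ _ f [set c]) => // Q _; exact: cf.
have -> : [set Q : 'M[R]_n | is_rot Q] =
    (\bigcap_(ij in [set: 'I_n * 'I_n])
       [set Q : 'M[R]_n | (Q^T *m Q) ij.1 ij.2 = (1%:M : 'M[R]_n) ij.1 ij.2])
    `&` [set Q | \det Q = 1].
  apply/seteqP; split=> [Q [QQ dQ]|Q [QQ dQ]]; split=> //=; first by move=> ij _; rewrite /= QQ.
  by apply/matrixP => i j; exact: (QQ (i, j)).
apply: closedI; last by apply: cl; exact: continuous_det.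
by apply: closed_bigI => ij _; apply: cl; exact: continuous_gram.
Qed.

(** Rotation matrices have entries in [[-1, 1]], so they form a closed subset of the image of a
    compact cube under the continuous map [vec_mx]. *)
Lemma compact_rot : compact [set Q : 'M[R]_n | is_rot Q].
Proof.
pose cube := [set v : 'rV[R]_(n * n) | forall i, `[(-1 : R), 1]%classic (v ord0 i)].
apply: (@subclosed_compact _ _ (vec_mx @` cube : set 'M[R]_n)).
- exact: closed_rot.
- apply: continuous_compact; last first.
    by apply: (@rV_compact R _ (fun=> `[(-1 : R), 1]%classic)) => i; exact: segment_compact.
  apply: continuous_subspaceT => v A /nbhs_ballP[e /= e0 eA].
  apply/nbhs_ballP; exists e => //= w [_ vw]; apply: eA; split=> // i j.
  by rewrite !mxE.
- move=> Q rQ; exists (mxvec Q); last exact: mxvecK.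
  move=> k; case/mxvec_indexP: k => i j; rewrite mxvecE /= in_itv/= -ler_norml.
  exact: rot_entry_le.
Qed.

(** The cluster point is stated in operator form, ready for estimates on vectors; it serves both for
    minimizing rotations and for powers of a rotation. *)
Lemma rot_cluster (F : set_system 'M[R]_n) : ProperFilter F ->
  F [set Q | is_rot Q] ->
  exists2 Q, is_rot Q & forall e U, 0 < e -> F U ->
    exists2 Q', U Q' & forall u, nrm (Q *m u - Q' *m u) <= e * nrm u.
Proof.
move=> FF /compact_rot[Q [rQ clQ]]; exists Q => // e U e0 FU.
(* Dividing by [n + 1] stays meaningful for [n = 0] and absorbs the factor [n] of [nrm_mulmx_le]. *)
have d0 : 0 < e / n.+1%:R by rewrite divr_gt0.
have [Q' [UQ' [_ QQ']]] := clQ _ _ FU (nbhsx_ballx Q _ d0).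
exists Q' => // u; rewrite -mulmxBl.
apply: (@le_trans _ _ (n%:R * (e / n.+1%:R) * nrm u)).
  apply: nrm_mulmx_le => [|i j]; first exact: ltW.
  by rewrite !mxE; apply: ltW; exact: QQ'.
rewrite ler_wpM2r ?nrm_ge0// mulrCA ler_piMr ?(ltW e0)//.
by rewrite ler_pdivrMr// mul1r ler_nat.
Qed.

End Compact.

(** * Lattices and their cells *)

Lemma finite_set_argmin (R : realType) (T : choiceType) (S : set T) (f : T -> R) :
  finite_set S -> S !=set0 -> exists2 x, S x & forall y, S y -> f x <= f y.
Proof.
move=> /finite_seqP[s ->]; elim: s => [[x]//|a s ih _].
have [[x xs]|s0] := pselect ([set` s] !=set0); last first.
  exists a => [|y]; first by rewrite /= mem_head.
  by rewrite /= inE => /orP[/eqP->//|ys]; case: s0; exists y.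
have [b bs hb] := ih (ex_intro _ x xs).
have [ab|ba] := leP (f a) (f b).
  exists a => [|y]; first by rewrite /= mem_head.
  by rewrite /= inE => /orP[/eqP->//|/hb]; exact: le_trans.
exists b => [|y]; first by rewrite /= inE; apply/orP; right.
by rewrite /= inE => /orP[/eqP->|/hb//]; exact: ltW.
Qed.

Section Lattice.
Variables (R : realType) (n : nat).
Implicit Types (u v w p q : 'cV[R]_n) (B C Q : 'M[R]_n) (x : 'I_n -> int).

Definition icol x : 'cV[R]_n := \col_i (x i)%:~R.

Lemma lattP B p : latt B p <-> exists x, p = B *m icol x.
Proof.
suff e x : \sum_(i < n) ((x i)%:~R : R) *: col i B = B *m icol x.
  by split=> -[x ->]; exists x; rewrite e.
apply/matrixP => i j; rewrite summxE mxE; apply: eq_bigr => k _.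
by rewrite !mxE mulrC.
Qed.

Lemma latt_subr B p q : latt B p -> latt B q -> latt B (p - q).
Proof.
move=> /lattP[x ->] /lattP[y ->]; apply/lattP; exists (fun i => x i - y i).
by rewrite -mulmxBr; congr mulmx; apply/matrixP => i j; rewrite !mxE intrB.
Qed.

Lemma latt0 B : latt B 0.
Proof.
apply/lattP; exists (fun=> 0); rewrite (_ : icol _ = 0) ?mulmx0//.
by apply/matrixP => i j; rewrite !mxE.
Qed.

Lemma latt_addr B p q : latt B p -> latt B q -> latt B (p + q).
Proof.
move=> Bp Bq; rewrite -[q]opprK; apply: latt_subr => //.
by rewrite -[- q]add0r; apply: latt_subr => //; exact: latt0.
Qed.

Lemma rot_img_latt Q B : rot_img Q (latt B) = latt (Q *m B).
Proof.
apply/seteqP; split=> [_ [_ /lattP[x ->] <-]|_ /lattP[x ->]].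
  by apply/lattP; exists x; rewrite mulmxA.
by exists (B *m icol x); [apply/lattP; exists x|rewrite mulmxA].
Qed.

(** A nonzero integer vector [x] has norm at least 1, and [|x| <= K * |B x|] with [K] a bound for
    the inverse of [B]. *)
Lemma latt_min B : B \in unitmx ->
  exists2 m, 0 < m & forall q, latt B q -> q != 0 -> m <= nrm q.
Proof.
move=> uB; have [K K0 hK] := mulmx_bounded (invmx B).
exists K^-1 => [|q /lattP[x ->] Bx]; first by rewrite invr_gt0.
rewrite -[K^-1]mulr1 ler_pdivrMl//; apply: le_trans (hK _).
rewrite mulKmx//; have [i xi] : exists i, x i != 0.
  apply: contrapT => h; case/eqP: Bx; rewrite (_ : icol x = 0) ?mulmx0//.
  apply/matrixP => i j; rewrite !mxE; have [->//|xi] := eqVneq (x i) 0.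
  by case: h; exists i.
apply: le_trans (coord_le_nrm _ i); rewrite mxE.
rewrite -intr_norm -[1]/(1%:~R) ler_int; lia.
Qed.

(** Rounding down the coordinates of [p] gives a lattice vector [q] with [p - q] in the fundamental
    parallelepiped; a point of the cell is no farther from 0 than from [q]. *)
Lemma voronoi_le B p : B \in unitmx -> voronoi (latt B) p ->
  nrm p <= \sum_i nrm (col i B).
Proof.
move=> uB /voronoiE Vp; pose y := invmx B *m p.
pose q := B *m icol (fun i => Num.floor (y i ord0)).
have pq : nrm p <= nrm (p - q).
  have /Vp : latt B q by apply/lattP; eexists.
  move=> h; rewrite /nrm ler_sqrt ?dot_ge0// !dotS (dotC q p); lra.
apply: (le_trans pq).
have -> : p - q = \sum_i (y i ord0 - (Num.floor (y i ord0))%:~R) *: col i B.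
  rewrite -[p](mulKVmx uB) -/y -mulmxBr; apply/matrixP => i j.
  rewrite summxE mxE; apply: eq_bigr => k _.
  by rewrite !mxE (ord1 j) mulrC.
apply: (le_trans (nrm_sum _ _)); apply: ler_sum => i _; rewrite nrmZ.
apply: ler_piMl => //; have := floor_itv (y i ord0); rewrite intrD => /andP[h1 h2].
by rewrite ler_norml; apply/andP; split; lra.
Qed.

Lemma voronoi_bounded B : B \in unitmx ->
  exists2 r, 0 < r & forall p, voronoi (latt B) p -> nrm p <= r.
Proof.
move=> uB; exists (1 + \sum_i nrm (col i B)) => [|p /(voronoi_le uB) h].
  by rewrite ltr_pwDl// sumr_ge0.
by apply: (le_trans h); rewrite lerDr.
Qed.

Lemma voronoi_ball B : B \in unitmx ->
  exists2 m, 0 < m & forall p, nrm p <= m -> voronoi (latt B) p.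
Proof.
move=> uB; have [m m0 hm] := latt_min uB; exists (m / 2) => [|p pm]; first lra.
apply/voronoiE => q Lq; have [->|q0] := eqVneq q 0; first by rewrite dotC !dot0l mulr0.
have := hm _ Lq q0; have := dot_le p q; rewrite -sqr_nrm; have := nrm_ge0 q; nra.
Qed.

Lemma latt_finite B r : B \in unitmx ->
  finite_set [set v | latt B v /\ nrm v <= r].
Proof.
move=> uB; have [K K0 hK] := mulmx_bounded (invmx B).
pose N := (Num.trunc (K * r)%R).+1.
(* Coordinates of short vectors lie in [[-N, N]]; shifting by [N] encodes them in the [2N + 1]
   ordinals. *)
pose g (f : {ffun 'I_n -> 'I_(N + N).+1}) := B *m icol (fun i => (f i)%:Z - N%:Z).
apply: (@sub_finite_set _ _ (range g)); last by apply: finite_image; exact: finite_finset.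
move=> _ [/lattP[x ->] xr]; exists [ffun i => inord (absz (x i + N%:Z)%R)] => //.
congr mulmx; apply/matrixP => i j; rewrite !mxE ffunE.
have xN : `|x i| <= N%:Z.
  rewrite -(ler_int R) intr_norm; apply: (@le_trans _ _ (K * r)).
    apply: (@le_trans _ _ (nrm (icol x))).
      by have := coord_le_nrm (icol x) i; rewrite mxE.
    rewrite -(mulKmx uB (icol x)); apply: (le_trans (hK _)).
    by rewrite ler_pM2l.
  by rewrite ltW// -[_%:~R]/(_%:R) truncnS_gt.
by rewrite inordK; [congr (_%:~R); lia | lia].
Qed.

(** Long lattice vectors satisfy the inequality automatically, and the finitely many remaining ones
    have a common positive slack that survives a small move of [u]. *)
Lemma strict_stable B u (P : set 'cV[R]_n) : B \in unitmx ->
  (forall a, latt B a -> P a -> 2 * dot u a < dot a a) ->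
  exists2 e, 0 < e & forall p, nrm (p - u) <= e ->
    forall a, latt B a -> P a -> 2 * dot p a <= dot a a.
Proof.
move=> uB h; pose r := nrm u + 1; have r0 : 0 < r by rewrite ltr_wpDl.
pose S := [set a | (latt B a /\ nrm a <= 2 * r) /\ P a].
have [g g0 hg] : exists2 g, 0 < g & forall a, S a -> g <= dot a a - 2 * dot u a.
  have [S0|S0] := pselect (S !=set0); last by exists 1 => // a Sa; case: S0; exists a.
  have fS : finite_set S by apply: sub_finite_set (@latt_finite B (2 * r) uB) => a [].
  have [a [[La _] Pa] ha] := finite_set_argmin (fun a => dot a a - 2 * dot u a) fS S0.
  by exists (dot a a - 2 * dot u a) => //; rewrite subr_gt0 h.
(* Within distance 1 of [u], [|p| <= r], which settles [|a| > 2 * r]; otherwise [2 * dot (p - u) a]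
   is at most [2 * (g / (4 * r)) * (2 * r) = g]. *)
exists (Num.min 1 (g / (4 * r))) => [|p].
  by rewrite lt_min ltr01 divr_gt0// mulr_gt0.
rewrite le_min ler_pdivlMr ?mulr_gt0// => /andP[pu1 pug] a La Pa.
have [ar|ar] := leP (nrm a) (2 * r).
  have /hg ga : S a by [].
  have -> : p = u + (p - u) by rewrite addrC subrK.
  have := ler_wpM2l (nrm_ge0 (p - u)) ar.
  by rewrite dotDl; have := dot_le (p - u) a; lra.
have pr : nrm p <= r by rewrite -(subrK u p) addrC (le_trans (nrmD _ _))// lerD2l.
have := dot_le p a; rewrite -sqr_nrm; have := nrm_ge0 a; nra.
Qed.

(* A shortest [v] in [latt B] outside [latt C] is Voronoi-relevant: if some
   [a <> 0, v] were active at [v / 2], then [v = a + (v - a)] would be a sum of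
   two shorter vectors.  Hence near [v / 2] the cell of [latt B] is the
   half-space of [v], and a vector of [latt C] active at [v / 2] must be [v]. *)
Lemma latt_sub_of_voronoi B C : B \in unitmx -> C \in unitmx ->
  voronoi (latt B) = voronoi (latt C) -> latt B `<=` latt C.
Proof.
move=> uB uC VBC v0 Bv0; apply: contrapT => Cv0.
have [v [[Bv _] Cv] vmin] : exists2 v, [set v | (latt B v /\ nrm v <= nrm v0) /\ ~ latt C v] v
    & forall w, (latt B w /\ nrm w <= nrm v0) /\ ~ latt C w -> nrm v <= nrm w.
  apply: finite_set_argmin; last by exists v0.
  by apply: sub_finite_set (@latt_finite B (nrm v0) uB) => a [].
have vshort w : latt B w -> nrm w < nrm v -> latt C w.
  move=> Bw wv; apply: contrapT => Cw.
  have [wv0|vw0] := leP (nrm w) (nrm v0).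
    by have := vmin w (conj (conj Bw wv0) Cw); rewrite leNgt wv.
  have := vmin v0 (conj (conj Bv0 (lexx _)) Cv0); lra.
have vn0 : v != 0 by apply: contra_notN Cv => /eqP ->; exact: latt0.
have vv := dot_gt0 vn0.
have [h hE] : exists h, forall w, 2 * dot h w = dot v w.
  by exists (2^-1 *: v) => w; rewrite dotZl mulrA mulfV ?mul1r.
have hstrict a : latt B a -> a != 0 /\ a != v -> 2 * dot h a < dot a a.
  rewrite hE => Ba [a0 av]; rewrite ltNge; apply/negP => va; apply: Cv.
  have d0 : v - a != 0 by rewrite subr_eq0 eq_sym.
  have vE : dot v v = dot a a + dot (v - a) (v - a) + 2 * (dot v a - dot a a).
    by rewrite !dotS (dotC a v); ring.
  have := dot_gt0 a0; have := dot_gt0 d0 => p1 p2.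
  have -> : v = a + (v - a) by rewrite addrC subrK.
  apply: latt_addr; apply: vshort => //; try exact: latt_subr;
    by rewrite -ltr_sqr ?nnegrE// !sqr_nrm; lra.
have [e e0 he] := strict_stable uB hstrict.
have half p : nrm (p - h) <= e -> 2 * dot p v <= dot v v -> voronoi (latt B) p.
  move=> pe pv; apply/voronoiE => a Ba.
  have [->|a0] := eqVneq a 0; first by rewrite dotC !dot0l mulr0.
  have [->//|av] := eqVneq a v; exact: he.
have Vh : voronoi (latt B) h by apply: half; rewrite ?subrr ?nrm0 ?hE// ltW.
(* If no vector of [latt C] were active at [h = v / 2], its cell would contain a ball about [h]; but
   moving from [h] along [v] leaves the cell of [latt B]. *)
have [w [Cw w0 hw]] : exists w, [/\ latt C w, w != 0 & dot v w = dot w w].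
  apply: contrapT => hC.
  have cs a : latt C a -> a != 0 -> 2 * dot h a < dot a a.
    move=> Ca a0; rewrite lt_neqAle; move: Vh; rewrite VBC => /voronoiE -> //.
    rewrite andbT; apply/eqP => ha; apply: hC; exists a; split=> //.
    by rewrite -hE.
  have [d d0 hd] := strict_stable uC cs.
  pose t := d / nrm v; have nv := nrm_gt0 vn0; have t0 : 0 < t by rewrite divr_gt0.
  have : voronoi (latt C) (h + t *: v).
    apply/voronoiE => a Ca.
    have [->|a0] := eqVneq a 0; first by rewrite dotC !dot0l mulr0.
    apply: hd => //; rewrite addrC addKr nrmZ gtr0_norm// mulfVK//.
    by rewrite gt_eqF.
  rewrite -VBC => /voronoiE/(_ v Bv); rewrite dotDl mulrDr hE dotZl; nra.
pose c := dot w v / dot v v.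
have [d dE] : exists d, d = w - c *: v by eexists.
have dv : dot d v = 0 by rewrite dE !dotS /c mulfVK ?subrr// gt_eqF.
(* [d] is the part of [w] orthogonal to [v]. Moving from [h] along a nonzero [d] keeps the
   constraint of [v] tight, hence stays in the cell of [latt B], but violates the constraint of
   [w]. *)
have d0 : d = 0.
  apply/eqP/negPn/negP => d0; have dd := dot_gt0 d0; have nd := nrm_gt0 d0.
  pose t := e / nrm d; have t0 : 0 < t by rewrite divr_gt0.
  have : voronoi (latt B) (h + t *: d).
    apply: half; last by rewrite dotDl dotZl dv mulr0 addr0 hE.
    by rewrite addrC addKr nrmZ gtr0_norm// mulfVK// gt_eqF.
  rewrite VBC => /voronoiE/(_ w Cw); rewrite dotDl mulrDr hE hw dotZl.
  have : dot d d = dot d (w - c *: v) by rewrite {2}dE.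
  by rewrite dotDr dotNr dotZr dv mulr0 subr0 => <-; have := mulr_gt0 t0 dd; lra.
have wE : w = c *: v by apply/eqP; rewrite -subr_eq0 -dE d0.
have cn0 : c != 0 by apply: contra_neq w0 => c0; rewrite wE c0 scale0r.
have c1 : c = 1.
  move: hw; rewrite wE dotZr dotZl => hw.
  by apply: (mulIf (lt0r_neq0 vv)); rewrite mul1r -dotZr -(mulfI cn0 hw).
by apply: Cv; rewrite -(scale1r v) -c1 -wE.
Qed.

Lemma voronoi_inj B C : B \in unitmx -> C \in unitmx ->
  voronoi (latt B) = voronoi (latt C) -> latt B = latt C.
Proof. by move=> uB uC e; apply/seteqP; split; exact: latt_sub_of_voronoi. Qed.

End Lattice.

(** * The scale *)

Section Scale.
Variables (R : realType) (n : nat).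
Implicit Types (u v w p q : 'cV[R]_n) (B C P Q : 'M[R]_n) (L : set 'cV[R]_n).

(** * Algebra of dilations and admissible scales *)

Lemma dilM s t L : dil s (dil t L) = dil (s * t) L.
Proof.
apply/seteqP; split=> [_ [_ [x Lx <-] <-]|_ [x Lx <-]].
  by exists x; rewrite // scalerA.
by exists (t *: x); rewrite ?scalerA//; exists x.
Qed.

Lemma dil1 L : dil 1 L = L.
Proof.
apply/seteqP; split=> [_ [x Lx <-]|x Lx]; first by rewrite scale1r.
by exists x; rewrite ?scale1r.
Qed.

Lemma rot_img_dil Q s L : rot_img Q (dil s L) = dil s (rot_img Q L).
Proof.
apply/seteqP; split=> _ [_ [x Lx <-] <-].
  by exists (Q *m x); [exists x|rewrite scalemxAr].
by exists (s *: x); [exists x|rewrite scalemxAr].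
Qed.

Lemma dil_sub s L L' : L `<=` L' -> dil s L `<=` dil s L'.
Proof. by move=> LL' _ [x /LL' Lx <-]; exists x. Qed.

Lemma scale_setP L L' s : scale_set L L' s <-> 0 < s /\ exists2 Q, is_rot Q &
  forall p q, voronoi L p -> L' q -> 2 * dot (Q *m p) q <= s * dot q q.
Proof.
split=> -[s0 [Q]].
  move=> [rQ QV]; split=> //; exists Q => // p q Vp.
  by apply: (dil_voronoiE L' _ s0).1; apply: QV; exists p.
move=> rQ h; split=> //; exists Q; split=> // _ [p Vp <-].
by apply/dil_voronoiE => // q; exact: h.
Qed.

Lemma scale_set1 L L' : scale_set L L' 1 <->
  exists2 Q, is_rot Q & rot_img Q (voronoi L) `<=` voronoi L'.
Proof.
rewrite /scale_set /= dil1; split=> [[_ [Q [rQ h]]]|[Q rQ h]]; first by exists Q.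
by split=> //; exists Q.
Qed.

Lemma scale_setM L L' L'' s t :
  scale_set L L' s -> scale_set L' L'' t -> scale_set L L'' (s * t).
Proof.
move=> [s0 [Q [rQ QV]]] [t0 [Q' [rQ' QV']]]; split; first exact: mulr_gt0.
exists (Q' *m Q); split; first exact: rotM.
move=> _ [p Vp <-]; rewrite -dilM -mulmxA.
have [x Vx <-] : dil s (voronoi L') (Q *m p) by apply: QV; exists p.
exists (Q' *m x); last by rewrite scalemxAr.
by apply: QV'; exists x.
Qed.

Lemma scale_set_dil l L L' : 0 < l ->
  scale_set (dil l L) (dil l L') = scale_set L L'.
Proof.
have dil_scale (k s : R) (M M' : set 'cV[R]_n) : 0 < k ->
    scale_set M M' s -> scale_set (dil k M) (dil k M') s.
  move=> k0 [s0 [Q [rQ QV]]]; split=> //; exists Q; split=> //.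
  by rewrite !voronoi_dil// rot_img_dil dilM mulrC -dilM; exact: dil_sub.
move=> l0; apply/seteqP; split=> s; last exact: dil_scale.
have li : 0 < l^-1 by rewrite invr_gt0.
by move=> /(dil_scale _ _ _ _ li); rewrite !dilM mulVf ?gt_eqF// !dil1.
Qed.

Lemma scale_le L L' s : scale_set L L' s -> scale L L' <= s.
Proof. by move=> h; apply: ge_inf => //; exists 0 => x [/ltW]. Qed.

Hypothesis n_gt0 : (0 < n)%N.

(** A ball of radius [m] inside the first cell must fit into [s] times a ball of radius [r] around
    the second. This requires a nonzero vector, hence positive dimension. *)
Lemma scale_set_lbound B C : B \in unitmx -> C \in unitmx ->
  exists2 c, 0 < c & lbound (scale_set (latt B) (latt C)) c.
Proof.
move=> uB uC; have [m m0 hm] := voronoi_ball uB; have [r r0 hr] := voronoi_bounded uC.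
exists (m / r) => [|s [s0 [Q [rQ QV]]]]; first exact: divr_gt0.
have [u u0] : exists u : 'cV[R]_n, u != 0.
  exists (const_mx 1); apply/eqP => /matrixP/(_ (Ordinal n_gt0) ord0).
  by rewrite !mxE; apply/eqP; exact: oner_neq0.
have nu := nrm_gt0 u0.
have pm : nrm ((m / nrm u) *: u) = m.
  by rewrite nrmZ gtr0_norm ?divr_gt0// mulfVK// gt_eqF.
have [x /hr xr xE] : dil s (voronoi (latt C)) (Q *m ((m / nrm u) *: u)).
  by apply: QV; eexists; last reflexivity; apply: hm; rewrite pm.
by rewrite ler_pdivrMr// -pm -(nrm_rot _ rQ) -xE nrmZ gtr0_norm// ler_pM2l.
Qed.

Lemma scale_set_nonempty B C : B \in unitmx -> C \in unitmx ->
  scale_set (latt B) (latt C) !=set0.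
Proof.
move=> uB uC; have [m m0 hm] := voronoi_ball uC; have [r r0 hr] := voronoi_bounded uB.
exists (r / m); split; first exact: divr_gt0.
exists 1%:M; split=> [|_ [p /hr pr <-]]; first exact: rot1.
apply/dilE; first exact: divr_gt0.
apply: hm; rewrite mul1mx nrmZ gtr0_norm ?invr_gt0 ?divr_gt0// invf_div.
by rewrite mulrAC ler_pdivrMr// ler_pM2l.
Qed.

Lemma scale_gt0 B C : B \in unitmx -> C \in unitmx -> 0 < scale (latt B) (latt C).
Proof.
move=> uB uC; have [c c0 hc] := scale_set_lbound uB uC.
by apply: (lt_le_trans c0); apply: lb_le_inf => //; exact: scale_set_nonempty.
Qed.

Lemma scale_min B C : B \in unitmx -> C \in unitmx ->
  scale_set (latt B) (latt C) (scale (latt B) (latt C)).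
Proof.
move=> uB uC; set L := latt B; set L' := latt C; set s := scale L L'.
(* The rotations admissible up to an error [e]: these sets shrink with [e] and are nonempty by the
   definition of the infimum, so they generate a proper filter. *)
pose K e := [set Q | is_rot Q /\
  forall p q, voronoi L p -> L' q -> 2 * dot (Q *m p) q <= (s + e) * dot q q].
have FF : ProperFilter (filter_from [set e : R | 0 < e] K).
  apply: filter_from_proper => [|e e0].
    apply: filter_from_filter => [|d e /= d0 e0]; first by exists 1; exact: ltr01.
    exists (Num.min d e) => [|Q [rQ h]]; first by rewrite /= lt_min d0.
    split; split=> // p q Vp Lq; apply: (le_trans (h p q Vp Lq));
      by rewrite ler_wpM2r ?dot_ge0// lerD2l ge_min lexx ?orbT.
  have [|t /scale_setP[t0 [Q rQ h]] ts] := inf_adherent (E := scale_set L L') e0.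
    split; first exact: scale_set_nonempty.
    by exists 0 => x [/ltW].
  exists Q; split=> // p q Vp Lq; apply: (le_trans (h p q Vp Lq)).
  by rewrite ler_wpM2r ?dot_ge0// ltW.
have [|Q rQ hQ] := rot_cluster FF; first by exists 1 => [|Q [//]]; exact: ltr01.
apply/scale_setP; split; first exact: scale_gt0.
exists Q => // p q Vp Lq; apply/ler_addgt0Pr => e e0.
(* With error [e / k], the term [dot q q] pays for the excess scale and [2 * |p| * |q|] for
   replacing [Q] by [Q']; the 1 keeps [k] positive. *)
pose k := dot q q + 2 * (nrm p * nrm q) + 1.
have k0 : 0 < k by rewrite ltr_wpDl// addr_ge0 ?dot_ge0 ?mulr_ge0.
have [||Q' [_ hQ'] QQ'] := hQ (e / k) (K (e / k)); first exact: divr_gt0.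
  by exists (e / k) => //; exact: divr_gt0.
have := hQ' p q Vp Lq; have := dot_le (Q *m p - Q' *m p) q.
have := ler_wpM2r (nrm_ge0 q) (QQ' p); rewrite dotDl dotNl.
have : e / k * (dot q q + 2 * (nrm p * nrm q) + 1) = e by rewrite mulfVK// gt_eqF.
have : 0 < e / k by rewrite divr_gt0.
by move: (e / k) => d; lra.
Qed.

(* The minimal [s] with [Q V <= s V] satisfies [s <= s ^ 2], by composing the
   inclusion with itself; this replaces the comparison of volumes. *)
Lemma scale_set_ge1 B s : B \in unitmx -> scale_set (latt B) (latt B) s -> 1 <= s.
Proof.
move=> uB /scale_le; apply: le_trans.
have := scale_le (scale_setM (scale_min uB uB) (scale_min uB uB)).
by rewrite -{1}[scale _ _]mulr1 ler_pM2l// scale_gt0.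
Qed.

Lemma scale_mul_ge1 B C : B \in unitmx -> C \in unitmx ->
  1 <= scale (latt B) (latt C) * scale (latt C) (latt B).
Proof.
by move=> uB uC; apply: (scale_set_ge1 uB); apply: scale_setM; exact: scale_min.
Qed.

(* Poincare recurrence: powers of [P] accumulate, so [P^-1] is a limit of
   positive powers of [P]. *)
Lemma voronoi_rot_sub P L : is_rot P ->
  rot_img P (voronoi L) `<=` voronoi L -> voronoi L `<=` rot_img P (voronoi L).
Proof.
move=> rP PV p Vp; apply/rot_imgK => //; apply/voronoiE => q Lq.
pose pw k := iter k (mulmx P) 1%:M.
have pwD k l : pw (k + l)%N = pw k *m pw l.
  by elim: k => [|k ih]; rewrite ?mul1mx// addSn /= ih mulmxA.
have rpw k : is_rot (pw k) by elim: k => [|k ih]; [exact: rot1|exact: rotM].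
have Vpw k : voronoi L (pw k *m p).
  by elim: k => [|k ih]; rewrite ?mul1mx// -mulmxA; apply: PV; exists (pw k *m p).
have Frot : \forall k \near \oo, is_rot (pw k) by exact: nearW.
have [Q rQ hQ] := rot_cluster (F := pw @ \oo) _ Frot.
have Fpw i : \forall j \near \oo, (pw @` [set j | (i <= j)%N]) (pw j).
  by apply: filterS (nbhs_infty_ge i) => j ij; exists j.
apply/ler_addgt0Pr => e e0.
pose k := 4 * (nrm p * nrm q) + 1.
have k0 : 0 < k by rewrite ltr_wpDl// !mulr_ge0.
have d0 : 0 < e / k by rewrite divr_gt0.
(* Two powers with [i < j] are both close to [Q], hence to each other; multiplying by the inverse of
   [P ^ (i + 1)] shows that [P^T] is close to [P ^ l] with [l = j - i - 1]. *)
have [_ [i _ <-] hi] := hQ _ _ d0 (Fpw 0%N).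
have [_ [j /= ij <-] hj] := hQ _ _ d0 (Fpw i.+1).
pose l := (j - i.+1)%N.
have near : nrm (P^T *m p - pw l *m p) <= 2 * (e / k) * nrm p.
  have -> : nrm (P^T *m p - pw l *m p) = nrm (pw i *m p - pw j *m p).
    rewrite -(nrm_rot _ (rotM (rpw i) rP)) mulmxBr !mulmxA -(mulmxA _ P).
    rewrite rot_mulKV// mulmx1 -(mulmxA (pw i)) -[P *m pw l]/(pw l.+1) -pwD.
    by rewrite /l addnS -addSn subnKC.
  rewrite -(subrKA (Q *m p)); apply: (le_trans (nrmD _ _)).
  by rewrite (nrmB (pw i *m p)); have := hi p; have := hj p; lra.
have /voronoiE/(_ q Lq) := Vpw l; have := dot_le (P^T *m p - pw l *m p) q.
have := ler_wpM2r (nrm_ge0 q) near; rewrite dotDl dotNl.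
have : e / k * (4 * (nrm p * nrm q) + 1) = e by rewrite mulfVK// gt_eqF.
by move: (e / k) d0 => d; lra.
Qed.

(** [Q' *m Q] maps the first cell into itself, hence onto itself, which forces [Q] to map the first
    cell onto the second; cells determine lattices. *)
Lemma rot_img_latt_of_scale B C : B \in unitmx -> C \in unitmx ->
  scale_set (latt B) (latt C) 1 -> scale_set (latt C) (latt B) 1 ->
  exists Q, is_rot Q /\ rot_img Q (latt B) = latt C.
Proof.
move=> uB uC /scale_set1[Q rQ QV] /scale_set1[Q' rQ' QV'].
exists Q; split=> //; rewrite rot_img_latt; apply: voronoi_inj => //.
  rewrite unitmx_mul uB andbT unitmxE; case: rQ => _ ->; exact: unitr1.
rewrite -rot_img_latt voronoi_rot//; apply/seteqP; split=> // p Vp.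
have /(voronoi_rot_sub (rotM rQ' rQ)) [|x Vx xE] : voronoi (latt B) (Q' *m p).
- by apply: QV'; exists p.
- by move=> _ [x Vx <-]; rewrite -mulmxA; apply: QV'; exists (Q *m x) => //; apply: QV; exists x.
exists x => //; case: rQ' => QQ' _.
by rewrite -[p]mul1mx -QQ' -mulmxA -xE !mulmxA QQ' mul1mx.
Qed.

(** Compare [y = C x] with [z = B x]: [2 p.y = 2 p.z + 2 p.(y - z)] is at most
    [|z| ^ 2 + 2 r d |y|]. Then [|z| <= (1 + d) |y|], and [m <= |y|] makes the linear term
    quadratic. *)
Lemma scale_set_perturb B C d r m t : B \in unitmx -> C \in unitmx -> 0 <= d -> 0 < m ->
  (forall x, nrm (B *m x - C *m x) <= d * nrm (C *m x)) ->
  (forall p, voronoi (latt B) p -> nrm p <= r) ->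
  (forall q, latt C q -> q != 0 -> m <= nrm q) ->
  (1 + d) ^+ 2 + 2 * r * d / m <= t -> scale_set (latt B) (latt C) t.
Proof.
move=> uB uC d0 m0 hd hr hm ht.
have r0 : 0 <= r.
  have [c c0 hc] := voronoi_ball uB; apply: le_trans (hr 0 _); first by rewrite nrm0.
  by apply: hc; rewrite nrm0 ltW.
have rdm : 0 <= 2 * r * d / m by rewrite divr_ge0 ?mulr_ge0// ltW.
apply/scale_setP; split; first by apply: lt_le_trans ht; nra.
exists 1%:M => [|p q Vp]; first exact: rot1.
rewrite mul1mx => /lattP[x ->]; set y := C *m icol R x.
have [->|y0] := eqVneq y 0; first by rewrite dotC !dot0l !mulr0.
apply: (@le_trans _ _ (((1 + d) ^+ 2 + 2 * r * d / m) * dot y y)); last first.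
  by rewrite ler_wpM2r ?dot_ge0.
have pB : 2 * dot p (B *m icol R x) <= dot (B *m icol R x) (B *m icol R x).
  by have /voronoiE := Vp; apply; apply/lattP; eexists.
set z := B *m icol R x in pB *.
have zy : nrm (z - y) <= d * nrm y by exact: hd.
have zn : nrm z <= (1 + d) * nrm y.
  by have := nrmD (z - y) y; rewrite subrK; lra.
have zz : dot z z <= (1 + d) ^+ 2 * dot y y.
  by rewrite -!sqr_nrm -exprMn ler_sqr ?nnegrE ?mulr_ge0// addr_ge0.
have pyz : dot p (y - z) <= r * (d * nrm y).
  by apply: (le_trans (dot_le _ _)); rewrite (nrmB y) ler_pM// hr.
have ym : 2 * r * d * nrm y <= 2 * r * d / m * dot y y.
  have -> : 2 * r * d / m * dot y y = 2 * r * d * nrm y * (nrm y / m).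
    by rewrite -sqr_nrm; field; rewrite gt_eqF.
  rewrite ler_peMr ?mulr_ge0// ler_pdivlMr// mul1r hm//.
  by apply/lattP; eexists.
by move: pyz; rewrite dotDr dotNr; lra.
Qed.

Lemma scale_set_near C t : C \in unitmx -> 1 < t -> exists2 h, 0 < h &
  forall B, B \in unitmx -> (forall i j, `|B i j - C i j| <= h) ->
    scale_set (latt B) (latt C) t /\ scale_set (latt C) (latt B) t.
Proof.
move=> uC t1; have [K K0 hK] := mulmx_bounded (invmx C).
have [m m0 hm] := latt_min uC.
(* The factor 2 lets [r] bound both cells, since the columns of a nearby [B] at most double in
   length. *)
have [r rE r0] : exists2 r, r = 2 * \sum_i nrm (col i C) & 0 <= r.
  by eexists; first reflexivity; rewrite mulr_ge0// sumr_ge0.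
(* For [d <= 1] and minimal norm [m / 2], the bound of [scale_set_perturb] is at most
   [1 + 3 d + 4 r d / m = 1 + d k]. *)
pose k := 3 + 4 * r / m.
have k0 : 0 < k.
  have : 0 <= 4 * r / m by rewrite divr_ge0 ?mulr_ge0 ?(ltW m0).
  by rewrite /k; lra.
pose d := Num.min 1 ((t - 1) / k).
have d0 : 0 < d by rewrite lt_min ltr01 divr_gt0 ?subr_gt0.
have d1 : d <= 1 by rewrite ge_min lexx.
have dk : d * k <= t - 1 by rewrite -ler_pdivlMr// ge_min lexx orbT.
have dt : (1 + d) ^+ 2 + 2 * r * d / (m / 2) <= t.
  have : d ^+ 2 <= d by rewrite expr2 ler_piMr// ltW.
  have -> : 2 * r * d / (m / 2) = d * (4 * r / m) by field; rewrite gt_eqF.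
  by move: dk; rewrite /k mulrDr; move: (d * (4 * r / m)) => z; lra.
(* Entries within this bound give [|B x - C x| <= (d / 2) |C x|]. As [|C x| <= 2 |B x|], this is at
   most [d |B x|], so the estimate works in both directions. *)
exists (d / 2 / (n%:R * K)) => [|B uB BC].
  by rewrite !divr_gt0// mulr_gt0// ltr0n.
have BCd x : nrm (B *m x - C *m x) <= d / 2 * nrm (C *m x).
  rewrite -mulmxBl; apply: (@le_trans _ _ (n%:R * (d / 2 / (n%:R * K)) * nrm x)).
    apply: nrm_mulmx_le => [|i j]; last by rewrite !mxE.
    by rewrite !divr_ge0 ?mulr_ge0// ltW.
  rewrite -[X in nrm X](mulKmx uC x).
  apply: (@le_trans _ _ (n%:R * (d / 2 / (n%:R * K)) * (K * nrm (C *m x)))).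
    by rewrite ler_wpM2l// mulr_ge0// !divr_ge0 ?mulr_ge0// ltW.
  have -> // : n%:R * (d / 2 / (n%:R * K)) * (K * nrm (C *m x)) = d / 2 * nrm (C *m x).
  field; rewrite gt_eqF// ?pnatr_eq0 -?lt0n ?n_gt0//.
have CB x : nrm (C *m x) <= 2 * nrm (B *m x).
  have := nrmD (C *m x - B *m x) (B *m x); rewrite subrK (nrmB (C *m x)).
  have := BCd x; have := nrm_ge0 (C *m x); nra.
have BC2 x : nrm (B *m x) <= 2 * nrm (C *m x).
  have := nrmD (B *m x - C *m x) (C *m x); rewrite subrK.
  have := BCd x; have := nrm_ge0 (C *m x); nra.
have hrC p : voronoi (latt C) p -> nrm p <= r.
  by move=> /(voronoi_le uC)/le_trans; apply; rewrite rE ler_peMl ?sumr_ge0// ler1n.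
have hrB p : voronoi (latt B) p -> nrm p <= r.
  move=> /(voronoi_le uB)/le_trans; apply; rewrite rE mulr_sumr.
  by apply: ler_sum => i _; rewrite !colE.
have hmB q : latt B q -> q != 0 -> m / 2 <= nrm q.
  move=> /lattP[x ->] Bx; have /hm : latt C (C *m icol R x) by apply/lattP; eexists.
  have Cx : C *m icol R x != 0.
    apply: contra_neq Bx => Cx; rewrite -[icol R x](mulKmx uC) Cx !mulmx0//.
  by move=> /(_ Cx); have := CB (icol R x); lra.
have hmC q : latt C q -> q != 0 -> m / 2 <= nrm q.
  by move=> Cq q0; have := hm q Cq q0; lra.
split; apply: (scale_set_perturb (d := d) (r := r) (m := m / 2)) => //;
  rewrite ?divr_gt0 ?(ltW d0)// => x.
  by apply: (le_trans (BCd x)); rewrite ler_wpM2r// ler_pdivrMr//; lra.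
rewrite nrmB; apply: (le_trans (BCd x)).
have := CB x; nra.
Qed.

End Scale.

(** * The distance *)

Section Distance.
Variables (R : realType) (n : nat).
Hypothesis n_gt0 : (0 < n)%N.
Implicit Types (B C D Q : 'M[R]_n) (L : set 'cV[R]_n).

Lemma d_sC L L' : d_s L L' = d_s L' L.
Proof. by rewrite /d_s maxC. Qed.

Lemma max_scale_gt0 B C : B \in unitmx -> C \in unitmx ->
  0 < Num.max (scale (latt B) (latt C)) (scale (latt C) (latt B)).
Proof. by move=> uB uC; rewrite lt_max scale_gt0. Qed.

(** The two scales have product at least 1, so they cannot both be below 1. *)
Lemma max_scale_ge1 B C : B \in unitmx -> C \in unitmx ->
  1 <= Num.max (scale (latt B) (latt C)) (scale (latt C) (latt B)).
Proof.
move=> uB uC; have := scale_mul_ge1 n_gt0 uB uC.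
have := scale_gt0 n_gt0 uB uC; have := scale_gt0 n_gt0 uC uB.
by rewrite le_max => c0 b0 bc; have [//|b1] := leP 1 (scale (latt B) _); rewrite /=; nra.
Qed.

Lemma d_s_ge0 B C : B \in unitmx -> C \in unitmx -> 0 <= d_s (latt B) (latt C).
Proof. by move=> uB uC; rewrite ln_ge0// max_scale_ge1. Qed.

Lemma d_s_le_ln B C t : B \in unitmx -> C \in unitmx ->
  scale_set (latt B) (latt C) t -> scale_set (latt C) (latt B) t ->
  d_s (latt B) (latt C) <= ln t.
Proof.
move=> uB uC hB hC; rewrite ler_ln ?posrE ?max_scale_gt0//; last by case: hB.
by rewrite ge_max !scale_le.
Qed.

Lemma d_s_eq0 B C : B \in unitmx -> C \in unitmx ->
  d_s (latt B) (latt C) = 0 <-> exists Q, is_rot Q /\ rot_img Q (latt B) = latt C.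
Proof.
move=> uB uC; split=> [/eqP|[Q [rQ QBC]]].
  rewrite ln_eq0 ?max_scale_gt0// => /eqP m1.
  have b1 : scale (latt B) (latt C) <= 1 by rewrite -m1 le_max lexx.
  have c1 : scale (latt C) (latt B) <= 1 by rewrite -m1 le_max lexx orbT.
  (* Both scales are at most 1 with product at least 1, hence both equal 1. *)
  have bc := scale_mul_ge1 n_gt0 uB uC.
  have b0 := scale_gt0 n_gt0 uB uC; have c0 := scale_gt0 n_gt0 uC uB.
  apply: (rot_img_latt_of_scale uB uC).
    suff <- : scale (latt B) (latt C) = 1 by exact: scale_min.
    by apply/eqP; rewrite eq_le b1/=; nra.
  suff <- : scale (latt C) (latt B) = 1 by exact: scale_min.
  by apply/eqP; rewrite eq_le c1/=; nra.
apply/eqP; rewrite eq_le d_s_ge0// andbT -ln1.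
have VC : rot_img Q (voronoi (latt B)) = voronoi (latt C) by rewrite -voronoi_rot// QBC.
apply: d_s_le_ln => //; apply/scale_set1; first by exists Q; rewrite ?VC.
exists Q^T; first exact: rotT.
rewrite -VC => _ [_ [x Vx <-] <-]; case: rQ => QQ _.
by rewrite mulmxA QQ mul1mx.
Qed.

(** The scale is submultiplicative, because attained inclusions compose; the logarithm turns this
    into the triangle inequality. *)
Lemma d_s_triangle B C D : B \in unitmx -> C \in unitmx -> D \in unitmx ->
  d_s (latt B) (latt D) <= d_s (latt B) (latt C) + d_s (latt C) (latt D).
Proof.
move=> uB uC uD; rewrite -lnM ?posrE ?max_scale_gt0//.
have le_scale (F G H : 'M[R]_n) : F \in unitmx -> G \in unitmx -> H \in unitmx ->
    scale (latt F) (latt H) <= scale (latt F) (latt G) * scale (latt G) (latt H).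
  by move=> uF uG uH; apply: scale_le; apply: scale_setM; exact: scale_min.
rewrite ler_ln ?posrE ?mulr_gt0 ?max_scale_gt0// ge_max.
apply/andP; split; first apply: (le_trans (le_scale _ C _ uB uC uD)).
  by rewrite ler_pM ?le_max ?lexx ?(ltW (scale_gt0 _ _ _)).
apply: (le_trans (le_scale _ C _ uD uC uB)); rewrite mulrC.
by rewrite ler_pM ?le_max ?lexx ?orbT ?(ltW (scale_gt0 _ _ _)).
Qed.

Lemma d_s_dil l L L' : 0 < l -> d_s (dil l L) (dil l L') = d_s L L'.
Proof. by move=> l0; rewrite /d_s /scale !scale_set_dil. Qed.

Lemma d_s_near C e : C \in unitmx -> 0 < e -> exists2 h, 0 < h &
  forall B, B \in unitmx -> (forall i j, `|B i j - C i j| <= h) ->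
    d_s (latt B) (latt C) <= e.
Proof.
move=> uC e0; have t1 : 1 < expR e by rewrite expR_gt1.
have [h h0 hB] := scale_set_near n_gt0 uC t1; exists h => // B uB BC.
by have [s1 s2] := hB B uB BC; rewrite -[e]expRK; exact: d_s_le_ln.
Qed.

Lemma d_s_continuous :
  {within [set BB : 'M[R]_n * 'M[R]_n | BB.1 \in unitmx /\ BB.2 \in unitmx],
     continuous (fun BB : 'M[R]_n * 'M[R]_n => d_s (latt BB.1) (latt BB.2))}.
Proof.
apply/subspace_continuousP => -[C D] [/= uC uD] U /nbhs_ballP[e /= e0 eU].
have e4 : 0 < e / 4 by rewrite divr_gt0.
have [h h0 hC] := d_s_near uC e4; have [k k0 hD] := d_s_near uD e4.
apply/nbhs_ballP; exists (Num.min h k); first by rewrite /= lt_min h0.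
move=> [B E] [/= [_ BC] [_ ED]] [uB uE]; apply: eU.
have near_le (F G : 'M[R]_n) d : Num.min h k <= d ->
    (forall i j, ball (G i j) (Num.min h k) (F i j)) ->
    forall i j, `|F i j - G i j| <= d.
  by move=> hd FG i j; apply: le_trans hd; rewrite distrC; apply: ltW; exact: FG.
have BC4 : d_s (latt B) (latt C) <= e / 4.
  by apply: hC => //; apply: near_le BC; rewrite ge_min lexx.
have ED4 : d_s (latt E) (latt D) <= e / 4.
  by apply: hD => //; apply: near_le ED; rewrite ge_min lexx orbT.
(* The four triangles give [|d(C,D) - d(B,E)| <= d(B,C) + d(E,D) <= e / 2]. *)
have t1 := d_s_triangle uB uC uE; have t2 := d_s_triangle uC uD uE.
have t3 := d_s_triangle uC uB uD; have t4 := d_s_triangle uB uE uD.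
rewrite (d_sC (latt D)) in t2; rewrite (d_sC (latt C) (latt B)) in t3.
suff : `|d_s (latt C) (latt D) - d_s (latt B) (latt E)| < e by [].
by rewrite ltr_norml; apply/andP; split; lra.
Qed.

End Distance.

Unset Implicit Arguments.

(** Independence of the representation is built into the types: [scale] and [d_s] take point sets,
    not bases. *)
Theorem theorem4 (R : realType) (n : nat) (hn : (1 <= n)%N) :
  (* scale is a genuine minimum *)
  (forall L L' : set 'cV[R]_n, is_lattice L -> is_lattice L' ->
     scale_set L L' (scale L L')) /\
  (* (a) *)
  (forall L L' : set 'cV[R]_n, is_lattice L -> is_lattice L' ->
     0 <= d_s L L' /\
     (d_s L L' = 0 <-> exists Q : 'M[R]_n, is_rot Q /\ rot_img Q L = L')) /\
  (* (b) *)
  (forall L L' : set 'cV[R]_n, is_lattice L -> is_lattice L' ->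
     d_s L L' = d_s L' L) /\
  (* (c) *)
  (forall L L' L'' : set 'cV[R]_n,
     is_lattice L -> is_lattice L' -> is_lattice L'' ->
     d_s L L'' <= d_s L L' + d_s L' L'') /\
  (* (d) *)
  {within [set BB : 'M[R]_n * 'M[R]_n | BB.1 \in unitmx /\ BB.2 \in unitmx],
     continuous (fun BB : 'M[R]_n * 'M[R]_n => d_s (latt BB.1) (latt BB.2))} /\
  (* (e) *)
  (forall (L L' : set 'cV[R]_n) (lambda : R), is_lattice L -> is_lattice L' ->
     0 < lambda -> d_s (dil lambda L) (dil lambda L') = d_s L L').
Proof.
split=> [_ _ [B [uB ->]] [C [uC ->]]|]; first exact: scale_min.
split=> [_ _ [B [uB ->]] [C [uC ->]]|].
  by split; [exact: d_s_ge0|exact: d_s_eq0].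
split=> [L L' _ _|]; first exact: d_sC.
split=> [_ _ _ [B [uB ->]] [C [uC ->]] [D [uD ->]]|]; first exact: d_s_triangle.
split; first exact: d_s_continuous.
by move=> L L' l _ _; exact: d_s_dil.
Qed.
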